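(* Let $T$ be a complete first-order theory with infinite models in a countable relational language. Then the isomorphism relation $\cong^\omega_T$ on $\mathrm{Mod}^\omega_T$ is topologically smooth if and only if $T$ is $\omega$-categorical.
   Context: $\mathrm{Mod}^\omega_{\mathcal L}$ is the space of $\mathcal L$-structures with domain $\omega$, with topology generated by $N_{\mathcal Q}=\{\mathcal M:\mathcal Q$ is a substructure of the $\mathcal L'$-reduct of $\mathcal M\}$ for $\mathcal L'\subseteq\mathcal L$ finite and $\mathcal Q$ a finite $\mathcal L'$-structure with domain contained in $\omega$; $\mathrm{Mod}^\omega_T$ is the subspace of models of $T$. An equivalence relation $E$ on a topological space $X$ is topologically smooth if there exist a Hausdorff space $Y$ and a continuous map $f:X\to Y$ such that for all $x,y\in X$, $x\mathrel E y\iff f(x)=f(y)$. *)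

(* Defs.v *)
From HB Require Import structures.
From mathcomp Require Import all_boot all_order.
From mathcomp Require Import boolp classical_sets functions cardinality.
From mathcomp Require Import topology.

Set Implicit Arguments.
Unset Strict Implicit.
Unset Printing Implicit Defensive.

Local Open Scope classical_set_scope.
Local Open Scope card_scope.

Record language := Language { rel_symb : Type; arity : rel_symb -> nat }.

Definition countable_language (L : language) := countable [set: rel_symb L].

(* The domain is not required to be nonempty here; models of a theory are
   explicitly taken over inhabited types below. *)
Record structure (L : language) (A : Type) := Structure {
  interp : forall r : rel_symb L, set ((arity r).-tuple A)
}.

(* First-order formulas with equality whose free variables are among the
   n variables 'I_n. Quantification binds variable 0 of 'I_n.+1, and variable
   [lift ord0 j] of the body stands for variable j outside. *)
Inductive formula (L : language) : nat -> Type :=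
| fFalse n : formula L n
| fEq n (i j : 'I_n) : formula L n
| fRel n (r : rel_symb L) (t : (arity r).-tuple 'I_n) : formula L n
| fImp n (phi psi : formula L n) : formula L n
| fAll n (phi : formula L n.+1) : formula L n.

Arguments fFalse {L n}.
Arguments fEq {L n} i j.
Arguments fRel {L n} r t.

Definition fNot (L : language) (n : nat) (phi : formula L n) : formula L n :=
  fImp phi fFalse.

Definition sentence (L : language) := formula L 0.

Definition val_cons (A : Type) (n : nat) (a : A) (v : 'I_n -> A)
  (i : 'I_n.+1) : A := if unlift ord0 i is Some j then v j else a.

Fixpoint sat (L : language) (A : Type) (M : structure L A) (n : nat)
    (phi : formula L n) : ('I_n -> A) -> Prop :=
  match phi in formula _ n return ('I_n -> A) -> Prop with
  | fFalse _ => fun=> False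
  | fEq _ i j => fun v => v i = v j
  | fRel _ r t => fun v => interp M (map_tuple v t)
  | fImp _ phi psi => fun v => sat M phi v -> sat M psi v
  | fAll _ phi => fun v => forall a : A, sat M phi (val_cons a v)
  end.

Definition val_nil (A : Type) (i : 'I_0) : A := False_rect A (notF (ltn_ord i)).

Definition holds (L : language) (A : Type) (M : structure L A)
  (phi : sentence L) : Prop := sat M phi (@val_nil A).

Definition theory (L : language) := set (sentence L).

Definition is_model (L : language) (T : theory L) (A : Type)
    (M : structure L A) : Prop :=
  inhabited A /\ forall phi, T phi -> holds M phi.

Definition entails (L : language) (T : theory L) (phi : sentence L) : Prop :=
  forall (A : Type) (M : structure L A), is_model T M -> holds M phi.

Definition consistent (L : language) (T : theory L) : Prop :=
  exists (A : Type) (M : structure L A), is_model T M.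

Definition complete_theory (L : language) (T : theory L) : Prop :=
  consistent T /\ forall phi, entails T phi \/ entails T (fNot phi).

Definition has_infinite_model (L : language) (T : theory L) : Prop :=
  exists (A : Type) (M : structure L A), infinite_set [set: A] /\ is_model T M.

Definition isomorphic (L : language) (A B : Type) (M : structure L A)
    (N : structure L B) : Prop :=
  exists h : A -> B, bijective h /\
    forall (r : rel_symb L) (t : (arity r).-tuple A),
      interp M t <-> interp N (map_tuple h t).

Definition omega_categorical (L : language) (T : theory L) : Prop :=
  (exists (A : Type) (M : structure L A),
     [set: A] #= [set: nat] /\ is_model T M) /\
  forall (A B : Type) (M : structure L A) (N : structure L B),
    [set: A] #= [set: nat] -> [set: B] #= [set: nat] ->
    is_model T M -> is_model T N -> isomorphic M N.

Definition sublanguage (L : language) (L' : set (rel_symb L)) : language :=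
  @Language L' (fun r => arity (val r)).

Definition reduct (L : language) (L' : set (rel_symb L)) (A : Type)
    (M : structure L A) : structure (sublanguage L') A :=
  @Structure (sublanguage L') A (fun r => interp M (r := val r)).

Definition substructure (L : language) (A : Type) (D : set A)
    (Q : structure L D) (M : structure L A) : Prop :=
  forall (r : rel_symb L) (t : (arity r).-tuple D),
    interp Q t <-> interp M (map_tuple val t).

Definition Mod (L : language) : Type := structure L nat.

HB.instance Definition _ (L : language) := gen_eqMixin (Mod L).
HB.instance Definition _ (L : language) := gen_choiceMixin (Mod L).

Definition basic_nbhd (L : language) (L' : set (rel_symb L)) (D : set nat)
    (Q : structure (sublanguage L') D) : set (Mod L) :=
  [set M : Mod L | substructure Q (reduct L' M)].

Definition Mod_subbase (L : language) : set (set (Mod L)) :=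
  [set U | exists (L' : set (rel_symb L)) (D : set nat)
             (Q : structure (sublanguage L') D),
             [/\ finite_set L', finite_set D & U = basic_nbhd Q]].

HB.instance Definition _ (L : language) :=
  @isSubBaseTopological.Build (Mod L) (set (Mod L)) (@Mod_subbase L) id.

(* As a type, [ModT T] is the subtype of models of T on omega, with the
   subspace topology that the library puts on [set_type]. *)
Definition ModT (L : language) (T : theory L) : set (Mod L) :=
  [set M : Mod L | is_model T M].

Definition isoT (L : language) (T : theory L) (M N : ModT T) : Prop :=
  isomorphic (val M) (val N).

Definition topologically_smooth (X : topologicalType) (E : X -> X -> Prop) :
    Prop :=
  exists (Y : topologicalType) (f : X -> Y),
    [/\ hausdorff_space Y, continuous f & forall x y, E x y <-> f x = f y].

(* Main.v *)
(* Every isomorphism class of countable models is dense. A basic neighbourhood of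
   M prescribes finitely many relations on an initial segment of omega; that such
   a configuration occurs is an existential sentence, so by completeness it also
   occurs in any other model N, and a permutation of omega moves the occurrence
   onto the initial segment. A continuous invariant with values in a Hausdorff
   space is therefore constant, which leaves a single class. Conversely, when
   there is a single class a constant map witnesses smoothness. A countably
   infinite model exists by the downward Loewenheim-Skolem theorem. *)
Require Import Defs.
From mathcomp Require Import all_boot classical_sets topology.
From mathcomp Require Import boolp functions cardinality filter.

Set Implicit Arguments.
Unset Strict Implicit.
Unset Printing Implicit Defensive.

Local Open Scope classical_set_scope.
Local Open Scope card_scope.

(** * Pullbacks along elementary maps *)

Definition pullback (L : language) (A B : Type) (M : structure L A)
    (g : B -> A) : structure L B :=
  Structure (fun r t => interp M (map_tuple g t)).

(** The test is in universal form, dual to the existence of witnesses, because [fAll] is the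
    primitive quantifier. *)
Definition tarski_vaught (L : language) (A B : Type) (M : structure L A)
    (g : B -> A) : Prop :=
  forall n (phi : formula L n.+1) (v : 'I_n -> B),
    (forall b, sat M phi (val_cons (g b) (g \o v))) ->
    forall a, sat M phi (val_cons a (g \o v)).

Lemma map_tuple_comp (n : nat) (A B C : Type) (f : B -> C) (g : A -> B)
    (t : n.-tuple A) :
  map_tuple f (map_tuple g t) = map_tuple (f \o g) t.
Proof. by apply: val_inj; rewrite /= -map_comp. Qed.

Lemma comp_val_cons (A B : Type) (g : B -> A) (n : nat) (b : B)
    (v : 'I_n -> B) : g \o val_cons b v = val_cons (g b) (g \o v).
Proof. by apply/funext => i; rewrite /= /val_cons; case: unlift. Qed.

Lemma val_nilE (A : Type) (v : 'I_0 -> A) : v = @val_nil A.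
Proof. by apply/funext => -[]. Qed.

Lemma sat_pullback (L : language) (A B : Type) (M : structure L A)
    (g : B -> A) :
  injective g -> tarski_vaught M g ->
  forall n (phi : formula L n) (v : 'I_n -> B),
    sat (pullback M g) phi v <-> sat M phi (g \o v).
Proof.
move=> ginj tv n; elim=> {n} [n|n i j|n r t|n phi IH1 psi IH2|n phi IH] v //=.
- by split=> [->|/ginj].
- by rewrite map_tuple_comp.
- by rewrite IH1 IH2.
- split=> [H a|H b]; last by rewrite IH comp_val_cons.
  by apply: tv => b; rewrite -comp_val_cons -IH.
Qed.

Lemma is_model_pullback (L : language) (T : theory L) (A B : Type)
    (M : structure L A) (g : B -> A) :
  inhabited B -> injective g -> tarski_vaught M g ->
  is_model T M -> is_model T (pullback M g).
Proof.
move=> B0 ginj tv [_ MT]; split=> // phi /MT.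
by rewrite /holds sat_pullback // [_ \o _]val_nilE.
Qed.

Lemma bij_tarski_vaught (L : language) (A B : Type) (M : structure L A)
    (g : B -> A) : bijective g -> tarski_vaught M g.
Proof. by move=> [h _ gK] n phi v H a; rewrite -(gK a). Qed.

Lemma isomorphic_pullback (L : language) (A B : Type) (M : structure L A)
    (g : B -> A) : bijective g -> isomorphic (pullback M g) M.
Proof. by exists g. Qed.

Lemma isomorphic_sym (L : language) (A B : Type) (M : structure L A)
    (N : structure L B) : isomorphic M N -> isomorphic N M.
Proof.
move=> [h [[k hK kK] hMN]]; exists k; split; first by exists h.
move=> r t; rewrite hMN map_tuple_comp.
suff -> : map_tuple (h \o k) t = t by [].
by apply: val_inj; rewrite /= -[RHS]map_id; apply: eq_map => x; apply: kK.
Qed.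

Lemma isomorphic_trans (L : language) (A B C : Type) (M : structure L A)
    (N : structure L B) (P : structure L C) :
  isomorphic M N -> isomorphic N P -> isomorphic M P.
Proof.
move=> [h [hb hMN]] [k [kb kNP]]; exists (k \o h); split; first exact: bij_comp.
by move=> r t; rewrite hMN kNP map_tuple_comp.
Qed.

(** * Countability of formulas and the downward Loewenheim-Skolem theorem *)

Section FormulaCode.
Variables (L : language) (c : rel_symb L -> nat).
Hypothesis c_inj : injective c.

(** The index [n] is recorded at atoms only; compound formulas recover it from their subformulas. *)
Fixpoint formula_code (n : nat) (phi : formula L n) : GenTree.tree nat :=
  match phi with
  | fFalse n => GenTree.Node 0 [:: GenTree.Leaf n]
  | fEq n i j => GenTree.Node 1
      [:: GenTree.Leaf n; GenTree.Leaf (val i); GenTree.Leaf (val j)]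
  | fRel n r t => GenTree.Node 2 (GenTree.Leaf n :: GenTree.Leaf (c r) ::
      [seq GenTree.Leaf (val i) | i <- t])
  | fImp _ phi psi => GenTree.Node 3 [:: formula_code phi; formula_code psi]
  | fAll _ phi => GenTree.Node 4 [:: formula_code phi]
  end.

(** Two separate indices let the induction run before they are known to agree, hence the equality of
    dependent pairs. *)
Lemma formula_code_inj (n m : nat) (phi : formula L n) (psi : formula L m) :
  formula_code phi = formula_code psi ->
  Tagged (formula L) phi = Tagged (formula L) psi.
Proof.
elim: phi m psi => {n} [n|n i j|n r t|n phi1 IH1 phi2 IH2|n phi IH] m
  [{}m|{}m i' j'|{}m r' t'|{}m psi1 psi2|{}m psi] //= [].
- by move=> ->.
- by move=> nm; subst m => /val_inj -> /val_inj ->.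
- move=> nm; subst m => /c_inj rr; subst r' => tt.
  suff -> : t = t' by [].
  by apply: val_inj; apply: inj_map tt => x y [] /val_inj.
- move=> /IH1 E1 /IH2 E2; have nm : n = m by have := congr1 tag E1.
  by subst m; rewrite (eq_from_Tagged E1) (eq_from_Tagged E2).
- move=> /IH E; have [nm] : n.+1 = m.+1 by have := congr1 tag E.
  by subst m; rewrite (eq_from_Tagged E).
Qed.

End FormulaCode.

Lemma countable_formulas (L : language) : countable_language L ->
  exists d : nat -> {n & formula L n.+1}, forall p, exists k, d k = p.
Proof.
move=> /countable_injP[c /in2TT c_inj].
pose code (p : {n & formula L n.+1}) := pickle (formula_code c (tagged p)).
have code_inj : injective code.
  move=> [n phi] [m psi] /(pcan_inj pickleK) /(formula_code_inj c_inj) /= E.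
  have [nm] : n.+1 = m.+1 by have := congr1 tag E.
  by subst m; rewrite (eq_from_Tagged E).
pose p0 : {n & formula L n.+1} := existT _ 0 fFalse.
exists (fun k => if pselect (exists p, code p = k) is left e
                 then projT1 (cid e) else p0) => p.
exists (code p); case: pselect => [e|[]]; last by exists p.
by case: (cid e) => q /= /code_inj.
Qed.

(* The Skolem hull of [range base] is the image of a countable type of terms: a
   node labelled k stands for the Skolem function of the k-th formula [d k]. *)
Section SkolemHull.
Variables (L : language) (A : Type) (M : structure L A).
Variables (d : nat -> {n & formula L n.+1}) (base : nat -> A).

(** A counterexample, when there is one, suits the universal form of [tarski_vaught]. Reading the
    parameters from a list padded with [base 0] lets one type of trees serve all arities. *)
Definition skolem (k : nat) (s : seq A) : A :=
  let v (i : 'I_(tag (d k))) := nth (base 0) s i in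
  if pselect (exists a, ~ sat M (tagged (d k)) (val_cons a v)) is left e
  then projT1 (cid e) else base 0.

Fixpoint skolem_term (t : GenTree.tree nat) : A :=
  match t with
  | GenTree.Leaf k => base k
  | GenTree.Node k ts => skolem k (map skolem_term ts)
  end.

Lemma skolem_term_tarski_vaught :
  (forall p, exists k, d k = p) -> tarski_vaught M skolem_term.
Proof.
move=> d_surj n phi v H; apply: contrapT => /existsNP nH.
have [k dk] := d_surj (existT _ n phi).
(* This term evaluates to a counterexample, although [H] covers its value. *)
have := H (GenTree.Node k [seq v i | i <- enum 'I_n]).
suff : ~ sat M phi (val_cons (skolem k [seq skolem_term (v i) | i <- enum 'I_n])
                             (skolem_term \o v)).
  by rewrite /= -map_comp.
rewrite /skolem dk /=.
suff -> : (fun i : 'I_n => nth (base 0)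
    [seq skolem_term (v j) | j <- enum 'I_n] i) = skolem_term \o v.
  by case: pselect => // e; case: (cid e).
apply/funext => i; rewrite (nth_map i) ?size_enum_ord //.
by rewrite nth_ord_enum.
Qed.

End SkolemHull.

(** Parameters for [h] lift to [B] through [g]. This allows the redundant indexing of the hull by
    terms to be replaced by an injective one. *)
Lemma tarski_vaught_image (L : language) (A B C : Type) (M : structure L A)
    (g : B -> A) (h : C -> A) :
  range g = range h -> tarski_vaught M g -> tarski_vaught M h.
Proof.
move=> gh tv n phi v H.
have hg x : exists b, g b = h x.
  by have : range h (h x) by []; rewrite -gh => -[b _ <-]; exists b.
pose w i := projT1 (cid (hg (v i))).
have gw : g \o w = h \o v.
  by apply/funext => i; rewrite /w /=; case: cid.
rewrite -gw; apply: tv => b; rewrite gw.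
by have : range g (g b) by []; rewrite gh => -[x _ <-].
Qed.

Lemma downward_lowenheim_skolem (L : language) (A : Type) (M : structure L A) :
  countable_language L -> infinite_set [set: A] ->
  exists g : nat -> A, injective g /\ tarski_vaught M g.
Proof.
move=> Lc /infiniteP /card_leP[f].
pose base k : A := val (f (SigSub (mem_set (I : [set: nat] k)))).
have base_inj : injective base.
  by move=> x y /val_inj /(inj (mem_set I) (mem_set I)) [].
have [d d_surj] := countable_formulas Lc.
(* The hull is countable as an image of trees and infinite because it contains [range base], so
   [nat] enumerates it without repetition. *)
pose H := range (skolem_term M d base).
have Hc : countable H.
  exact: card_le_trans (card_image_le _ _) (countableP _).
have Hinf : infinite_set H.
  apply: (@sub_infinite_set _ (range base)).
    by move=> _ [k _ <-]; exists (GenTree.Leaf k).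
  rewrite (eq_finite_set (inj_card_eq _)); first exact: infinite_nat.
  by move=> x y _ _; apply: base_inj.
have /card_esym/card_bijP[g [h gK hK]] : H #= [set: nat].
  exact/eq_card_nat.
pose e k : A := val (g (SigSub (mem_set (I : [set: nat] k)))).
exists e; split.
  by move=> x y /val_inj /(can_inj gK) [].
have tv := @skolem_term_tarski_vaught _ _ M d base d_surj.
apply: (tarski_vaught_image _ tv).
apply/seteqP; split=> [a Ha|_ [k _ <-]].
  exists (val (h (SigSub (mem_set (Ha : H a))))) => //; rewrite /e.
  set y := SigSub _; have -> : y = h (SigSub (mem_set (Ha : H a))).
    exact: val_inj.
  by rewrite hK.
exact: set_valP.
Qed.

(** * Existential sentences and finite diagrams *)

Section DerivedConnectives.
Variable L : language.

Definition fAnd (n : nat) (phi psi : formula L n) : formula L n :=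
  fNot (fImp phi (fNot psi)).

Definition fEx (n : nat) (phi : formula L n.+1) : formula L n :=
  fNot (fAll (fNot phi)).

Definition fBigAnd (I : Type) (n : nat) (s : seq I) (F : I -> formula L n) :
    formula L n :=
  foldr (fun i => fAnd (F i)) (fNot fFalse) s.

Definition fLit (n : nat) (P : Prop) (phi : formula L n) : formula L n :=
  if `[< P >] then phi else fNot phi.

Fixpoint fExs (n : nat) : formula L n -> sentence L :=
  match n with
  | 0 => id
  | n.+1 => fun phi => fExs (fEx phi)
  end.

Variables (A : Type) (M : structure L A).

Lemma sat_fAnd (n : nat) (phi psi : formula L n) (v : 'I_n -> A) :
  sat M (fAnd phi psi) v <-> sat M phi v /\ sat M psi v.
Proof.
split=> [/= H|[H1 H2] /(_ H1 H2)] //.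
by split; apply: contrapT => nH; apply: H => Hphi // /nH.
Qed.

Lemma sat_fEx (n : nat) (phi : formula L n.+1) (v : 'I_n -> A) :
  sat M (fEx phi) v <-> exists a, sat M phi (val_cons a v).
Proof.
split=> [/= H|[a Ha] /(_ a Ha)] //.
by apply: contrapT => /forallNP nH; apply: H.
Qed.

Lemma sat_fBigAnd (I : eqType) (n : nat) (s : seq I) (F : I -> formula L n)
    (v : 'I_n -> A) :
  sat M (fBigAnd s F) v <-> forall i, i \in s -> sat M (F i) v.
Proof.
elim: s => [|i s IH]; first by split=> [_ j|_ []].
rewrite [fBigAnd _ _]/(fAnd (F i) (fBigAnd s F)) sat_fAnd IH.
split=> [[Fi Fs] j|H]; first by rewrite inE => /predU1P[->|/Fs].
by split=> [|j js]; apply: H; rewrite inE ?eqxx ?js ?orbT.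
Qed.

Lemma sat_fLit (n : nat) (P : Prop) (phi : formula L n) (v : 'I_n -> A) :
  sat M (fLit P phi) v <-> (sat M phi v <-> P).
Proof. by rewrite /fLit; case: asboolP => /= HP; tauto. Qed.

Lemma holds_fExs (n : nat) (phi : formula L n) :
  holds M (fExs phi) <-> exists v, sat M phi v.
Proof.
elim: n phi => [|n IH] phi /=.
  split=> [H|[v]]; first by exists (@val_nil A).
  by rewrite /holds; congr sat; apply/funext => -[].
rewrite IH; split=> [[v /sat_fEx[a H]]|[v H]]; first by exists (val_cons a v).
exists (v \o lift ord0); apply/sat_fEx; exists (v ord0).
suff -> : val_cons (v ord0) (v \o lift ord0) = v by [].
by apply/funext => i; rewrite /val_cons; case: unliftP => [j|] ->.
Qed.

End DerivedConnectives.

(** Negative literals are included because a basic neighbourhood prescribes failures too, and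
    equalities because a realization has to be extended to a permutation. [{classic rel_symb L}]
    supplies the decidable equality for membership in [s]. *)
Definition diagram (L : language) (A : Type) (M : structure L A)
    (s : seq {classic rel_symb L}) (n : nat) (w : 'I_n -> A) : formula L n :=
  fAnd
    (fBigAnd (enum 'I_n) (fun i => fBigAnd (enum 'I_n) (fun j =>
       fLit (w i = w j) (fEq i j))))
    (fBigAnd s (fun r => fBigAnd (enum {: (arity r).-tuple 'I_n}) (fun t =>
       fLit (interp M (map_tuple w t)) (fRel r t)))).

Lemma sat_diagram (L : language) (A B : Type) (M : structure L A)
    (N : structure L B) (s : seq {classic rel_symb L}) (n : nat)
    (w : 'I_n -> A) (u : 'I_n -> B) :
  sat N (diagram M s w) u <->
  (forall i j, u i = u j <-> w i = w j) /\
  forall (r : {classic rel_symb L}) (t : (arity r).-tuple 'I_n), r \in s ->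
    (interp N (map_tuple u t) <-> interp M (map_tuple w t)).
Proof.
rewrite sat_fAnd !sat_fBigAnd; split=> -[H1 H2]; split.
- move=> i j; have := H1 i (mem_enum _ _).
  by move=> /sat_fBigAnd /(_ j (mem_enum _ _)) /sat_fLit.
- move=> r t rs; have /sat_fBigAnd := H2 r rs.
  by move=> /(_ t (mem_enum _ _)) /sat_fLit.
- by move=> i _; apply/sat_fBigAnd => j _; apply/sat_fLit/H1.
- by move=> r rs; apply/sat_fBigAnd => t _; apply/sat_fLit/H2.
Qed.

(** The tuple [w] realizes its own diagram in [M], so [T] cannot refute the existential closure and
    hence entails it. *)
Lemma complete_diagram (L : language) (T : theory L) (A B : Type)
    (M : structure L A) (N : structure L B) (s : seq {classic rel_symb L})
    (n : nat) (w : 'I_n -> A) :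
  complete_theory T -> is_model T M -> is_model T N ->
  exists u, sat N (diagram M s w) u.
Proof.
move=> [_ /(_ (fExs (diagram M s w)))] TC MT NT; apply/holds_fExs.
case: TC => [/(_ _ _ NT)//|/(_ _ _ MT) []].
by apply/holds_fExs; exists w; apply/sat_diagram.
Qed.

(** * Neighbourhoods and density of isomorphism classes *)

Lemma extend_injection (n : nat) (u : 'I_n -> nat) : injective u ->
  exists h : nat -> nat, bijective h /\ forall i : 'I_n, h i = u i.
Proof.
elim: n u => [|n IH] u u_inj; first by exists id; split=> [|[]//]; exists id.
have [|h [hb hu]] := IH (u \o widen_ord (leqnSn n)).
  by move=> i j /u_inj /(congr1 val) /= /val_inj.
pose swap a b x : nat := if x == a then b else if x == b then a else x.
have swapK a b : involutive (swap a b).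
  move=> x; rewrite /swap; have [->|xa] := eqVneq x a.
    by rewrite eqxx; case: eqP.
  by have [->|xb] := eqVneq x b; rewrite ?eqxx // (negPf xa) (negPf xb).
(* The inductive [h] is right below [n]; the transposition corrects its value at [n] and fixes the
   earlier values, which differ from both swapped points by injectivity of [h] and [u]. *)
exists (swap (h n) (u ord_max) \o h); split.
  by apply: bij_comp => //; apply: inv_bij.
move=> i; rewrite /= /swap; case: (unliftP ord_max i) => [j|] ->; last first.
  by rewrite /= eqxx.
have -> : lift ord_max j = widen_ord (leqnSn n) j.
  by apply: val_inj; exact: lift_max.
rewrite (inj_eq (bij_inj hb)) ltn_eqF //= hu /=.
case: eqP => // /u_inj /(congr1 val) /= E.
by have := ltn_ord j; rewrite E ltnn.
Qed.

(** A working substitute for the neighbourhood filter: finitely many constraints are absorbed into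
    one list of symbols and one bound. *)
Definition agreement_filter (L : language) (M : Mod L) : set_system (Mod L) :=
  [set U | exists (s : seq {classic rel_symb L}) (n : nat),
     forall N : Mod L,
       (forall (r : {classic rel_symb L}) (t : (arity r).-tuple nat), r \in s ->
          (forall x, x \in t -> x < n) -> interp N t <-> interp M t) -> U N].

Lemma agreement_filterP (L : language) (M : Mod L) : Filter (agreement_filter M).
Proof.
split=> [|U V [s [n HU]] [s' [m HV]]|U V UV [s [n HU]]].
- by exists [::], 0.
- exists (s ++ s'), (maxn n m) => N H.
  split; [apply: HU|apply: HV] => r t rs tn; apply: H.
  + by rewrite mem_cat rs.
  + by move=> x /tn xn; rewrite leq_max xn.
  + by rewrite mem_cat rs orbT.
  + by move=> x /tn xn; rewrite leq_max xn orbT.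
- by exists s, n => N /HU /UV.
Qed.

Lemma agreement_filter_subbase (L : language) (M : Mod L) (U : set (Mod L)) :
  Mod_subbase U -> U M -> agreement_filter M U.
Proof.
move=> [L' [D [Q [L'fin Dfin ->]]]] QM.
have [s sE] : exists s : seq {classic rel_symb L}, L' = [set` s].
  exact/(@finite_seqP {classic rel_symb L}).
have Ls (r : {classic rel_symb L}) : L' r -> r \in s by rewrite sE.
have [ds dsE] := (finite_seqP D).1 Dfin.
have Dds x : D x -> x \in ds by rewrite dsE.
(* The successor makes the strict bound cover the largest element of [D]. *)
exists s, (\max_(x <- ds) x).+1 => N H r t.
rewrite (QM r t); apply: iff_sym; apply: H; first exact/Ls/set_valP.
move=> x /mapP[y _ ->]; rewrite ltnS.
by apply: leq_bigmax_seq => //; exact/Dds/set_valP.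
Qed.

Lemma nbhs_agreement_filter (L : language) (M : Mod L) (U : set (Mod L)) :
  nbhs M U -> agreement_filter M U.
Proof.
have Ffilter := agreement_filterP M.
rewrite nbhsE => -[B [[D' D'sub <-] [C D'C CM]] BU].
(* A single finite intersection of subbasic sets contains [M], so closure under finite intersections
   reduces the claim to the subbase. *)
have [F Fsub FC] := D'sub _ D'C.
apply: filterS BU _; apply: filterS (bigcup_sup D'C) _; rewrite -FC.
apply: filter_bigI => V VF; apply: agreement_filter_subbase.
  by have /set_mem := Fsub _ VF.
by move: CM; rewrite -FC; apply.
Qed.

Lemma isomorphic_dense (L : language) (T : theory L) (M N : Mod L)
    (U : set (Mod L)) :
  complete_theory T -> is_model T M -> is_model T N -> nbhs M U ->
  exists N' : Mod L, [/\ is_model T N', isomorphic N' N & U N'].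
Proof.
move=> TC MT NT /nbhs_agreement_filter[s [n HU]].
have [u /sat_diagram[u_eq u_rel]] :=
  complete_diagram s (fun i : 'I_n => val i) TC MT NT.
have [|h [hb hu]] := @extend_injection n u; first by move=> i j /u_eq /val_inj.
(* Renaming [N] along [h] lets each [i] below [n] play the role of [u i]. *)
exists (pullback N h); split.
- exact: is_model_pullback (inhabits 0) (bij_inj hb) (bij_tarski_vaught hb) NT.
- exact: isomorphic_pullback.
apply: HU => r t rs tn.
have [t' tE] : exists t' : (arity r).-tuple 'I_n, t = map_tuple val t'.
  exists [tuple Ordinal (tn _ (mem_tnth i t)) | i < arity r].
  by apply: eq_from_tnth => i; rewrite !tnth_map tnth_ord_tuple.
rewrite tE -(u_rel _ _ rs) /= map_tuple_comp.
by suff -> : h \o val = u by []; apply/funext => i; exact: hu.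
Qed.

(** * Smoothness and categoricity *)

Lemma smooth_isomorphic (L : language) (T : theory L) (M N : ModT T) :
  complete_theory T -> topologically_smooth (@isoT L T) ->
  isomorphic (val M) (val N).
Proof.
(* In the cluster form of the Hausdorff property, every neighbourhood of [f M] must meet every
   neighbourhood of [f N]; the common point will be [f N] itself. *)
move=> TC [Y [f [Yhaus fcont fE]]]; apply/fE; apply: Yhaus => U V fMU fNV.
have : nbhs M (f @^-1` U) by exact: fcont.
(* An open set of the subspace is the trace of an open [W] in [Mod L], where density applies. *)
rewrite nbhsE => -[_ [[W Wop <-] MW] WU].
have [|K [KT KN KW]] := isomorphic_dense TC (set_valP M) (set_valP N) (U := W).
  exact: open_nbhs_nbhs.
pose K' : ModT T := SigSub (mem_set (KT : ModT T K)).
exists (f N); split; last exact: nbhs_singleton.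
by rewrite -((fE K' N).1 KN); exact: (WU K').
Qed.

Lemma model_on_nat (L : language) (T : theory L) (A : Type)
    (M : structure L A) :
  [set: A] #= [set: nat] -> is_model T M ->
  exists N : ModT T, isomorphic (val N) M.
Proof.
move=> /card_set_bijP[f]; rewrite setTT_bijective => -[g fK gK] MT.
have gb : bijective g by exists f.
have gT : ModT T (pullback M g).
  exact: is_model_pullback (inhabits 0) (bij_inj gb) (bij_tarski_vaught gb) MT.
by exists (SigSub (mem_set gT)); exact: isomorphic_pullback.
Qed.

Theorem theorem3p10 (L : language) (T : theory L) :
  countable_language L -> complete_theory T -> has_infinite_model T ->
  topologically_smooth (@isoT L T) <-> omega_categorical T.
Proof.
move=> Lc TC [A0 [M0 [A0inf M0T]]]; split=> [Tsmooth|[_ Tcat]].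
  split=> [|A B M N Anat Bnat MT NT].
    have [g [ginj gtv]] := downward_lowenheim_skolem M0 Lc A0inf.
    exists nat, (pullback M0 g); split; first exact: card_eqxx.
    exact: is_model_pullback (inhabits 0) ginj gtv M0T.
  (* Smoothness only concerns models on [nat], so both models are first transported there. *)
  have [M' M'M] := model_on_nat Anat MT.
  have [N' N'N] := model_on_nat Bnat NT.
  apply: isomorphic_trans (isomorphic_sym M'M) _.
  exact: isomorphic_trans (smooth_isomorphic M' N' TC Tsmooth) N'N.
exists bool, (fun=> true); split; first exact: discrete_hausdorff.
  exact: cst_continuous.
by move=> M N; split=> // _; apply: Tcat => //; exact: set_valP.
Qed.
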